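(* For any $\alpha\in\mathbb C$ and any $n,k\in\mathbb N_0$, the following Rodrigues-type identities for the Laguerre polynomials hold (whenever the expressions involved are defined): $$L_n^{(\alpha+k)}(x)=\frac{(\alpha+k+1)_n}{x^k}\,(\alpha+k)(\alpha+k-1)\nabla_\alpha\cdots(\alpha+2)(\alpha+1)\nabla_\alpha\,(\alpha+1)\alpha\nabla_\alpha\,\frac{L_{n+k}^{(\alpha)}(x)}{(\alpha+1)_{n+k}},$$ $$L_n^{(\alpha+k)}(x)=\frac{(-1)^k(\alpha+1)_{n+k}}{n!\,x^k}\,\nabla_n^k\left(\frac{(n+k)!}{(\alpha+1)_{n+k}}L_{n+k}^{(\alpha)}(x)\right),$$ $$L_n^{(\alpha)}(x)=(-1)^k\frac{(n+1)_\alpha}{x^\alpha}\,\Delta_\alpha^k\left(\frac{x^\alpha}{(n-k+1)_\alpha}L_{n-k}^{(\alpha)}(x)\right)\qquad(k\le n),$$ $$L_n^{(\alpha)}(x)=\Delta_n^kL_{n-k}^{(\alpha+k)}(x),$$ $$L_n^{(\alpha+k)}(x)=\Delta_\alpha^kL_{n+k}^{(\alpha)}(x).$$ In the first identity there are $k$ successive factors $(\alpha+j)(\alpha+j-1)\nabla_\alpha$, $j=k,k-1,\dots,1$ (the one with $j=1$ applied first), each difference operator acting on the whole expression to its right regarded as a function of $\alpha$.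
   Context: $\mathbb N_0=\{0,1,2,\dots\}$; $(a)_n=a(a+1)\cdots(a+n-1)$ is the Pochhammer symbol, and for non-integer or complex second argument $(a)_\alpha=\Gamma(a+\alpha)/\Gamma(a)$. The Laguerre polynomials are $$L_n^{(\alpha)}(x)=\frac{(\alpha+1)_n}{n!}\,{}_1F_1(-n;\alpha+1;x)=\sum_{j=0}^n\frac{(\alpha+j+1)_{n-j}}{(n-j)!\,j!}(-x)^j,$$ with $L_m^{(\alpha)}=0$ for $m<0$. The operators are $\Delta_nf(n)=f(n+1)-f(n)$, $\nabla_nf(n)=f(n)-f(n-1)$, $\Delta_\alpha f(\alpha)=f(\alpha+1)-f(\alpha)$, $\nabla_\alpha f(\alpha)=f(\alpha)-f(\alpha-1)$, the other variables being fixed. *)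

(* Defs.v *)
From HB Require Import structures.
From mathcomp Require Export all_boot all_order all_algebra.
From mathcomp Require Export complex.
From mathcomp Require Export all_classical all_reals all_analysis.

Set Implicit Arguments.
Unset Strict Implicit.
Unset Printing Implicit Defensive.

Export Order.TTheory GRing.Theory Num.Theory.
Export numFieldNormedType.Exports.

Local Open Scope ring_scope.
Local Open Scope complex_scope.

Section DifferenceOperators.
Variables A V : nzRingType.

Definition fdiff (f : A -> V) : A -> V := fun a => f (a + 1) - f a.
Definition bdiff (f : A -> V) : A -> V := fun a => f a - f (a - 1).

End DifferenceOperators.

Section ComplexFunctions.
Variable R : realType.
Local Notation C := (R[i]).

Definition cexp (z : C) : C :=
  (expR (complex.Re z) * cos (complex.Im z))
    +i* (expR (complex.Re z) * sin (complex.Im z)).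

Definition cmod (z : C) : R :=
  Num.sqrt (complex.Re z ^+ 2 + complex.Im z ^+ 2).

(* Principal argument, with values in ]-pi, pi] for z != 0. *)
Definition carg (z : C) : R :=
  if 0 <= complex.Im z then acos (complex.Re z / cmod z)
  else - acos (complex.Re z / cmod z).

(* Principal logarithm; only meaningful for z != 0. *)
Definition clog (z : C) : C := ln (cmod z) +i* carg z.

(* Principal value of z ^ a; only meaningful for z != 0. *)
Definition cpow (z a : C) : C := cexp (a * clog z).

Definition poch (a : C) (n : nat) : C := \prod_(i < n) (a + i%:R).

(* Gauss's formula: Gamma z is the limit of N! N^z / (z (z+1) ... (z+N)). *)
Definition Gamma_seq (z : C) (N : nat) : C :=
  (N`!)%:R * cpow N%:R z / poch z N.+1.

(* The limit is taken separately on real and imaginary parts.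
   The value at the poles 0, -1, -2, ... is meaningless. *)
Definition Gamma (z : C) : C :=
  limn (fun N => complex.Re (Gamma_seq z N) : R)
    +i* limn (fun N => complex.Im (Gamma_seq z N) : R).

Definition Gamma_pole (z : C) : Prop := exists j : nat, z = - j%:R.

(* The Pochhammer symbol (a)_b with complex second argument. *)
Definition cpoch (a b : C) : C := Gamma (a + b) / Gamma a.

(* Indexed by int since L_m^(a) = 0 for m < 0 is part of the definition. *)
Definition laguerre (m : int) (a x : C) : C :=
  match m with
  | Posz n =>
      \sum_(j < n.+1)
        poch (a + j%:R + 1) (n - j) / ((n - j)`! * j`!)%:R * (- x) ^+ j
  | Negz _ => 0
  end.

(* (a+k)(a+k-1) nabla ... (a+2)(a+1) nabla (a+1) a nabla f, with k factors. *)
Fixpoint rodrigues_bdiff (k : nat) (f : C -> C) : C -> C :=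
  match k with
  | 0 => f
  | k'.+1 => fun a =>
      (a + k'.+1%:R) * (a + k'.+1%:R - 1) * bdiff (rodrigues_bdiff k' f) a
  end.

End ComplexFunctions.

(* Main.v *)
Require Import Defs.
From mathcomp Require Import ring lra.

(** Everything rests on two contiguous relations of the Laguerre polynomials,
    both obtained by comparing coefficients:
    - [laguerre_pascal], the difference in the parameter:
      [L_(m+1)^(a+1) - L_(m+1)^(a) = L_m^(a+1)];
    - [laguerre_degree], which relates neighbouring degrees:
      [(m+1) L_(m+1)^(a) = (m+a+1) L_m^(a) - x L_m^(a+1)].

    Each of the five identities is the [k]-fold iteration of a single step: one
    application of the difference operator sends a suitably normalised
    Laguerre polynomial to another one of the same family, up to a factor.
    For the forward differences of the bare polynomials the step is
    [laguerre_pascal], read as a difference in the degree or in the parameter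
    ([iter_fdiff_degree], [iter_fdiff_param]). For the backward differences in
    the degree it is [laguerre_degree] ([iter_bdiff_degree]), and for the nested
    backward differences in the parameter a combination of the two,
    [laguerre_param_down] ([rodrigues_bdiffE]).

    In the identity with [x ^ alpha] the step is again [laguerre_degree]
    ([iter_fdiff_cpow]), but the normalisation involves [x ^ a] and [Gamma (m +
    1 + a)] for complex [a], so it needs [Gamma (z + 1) = z * Gamma z] and
    [Gamma z != 0] away from the poles, for [Gamma] defined as Gauss's limit.
    To show that this limit exists and is not zero, the reciprocals of the
    terms are written as the partial products of an infinite product. Its
    factors are [exp (- z (ln (N + 1) - ln N)) * (1 + z / (N + 1)) = 1 + O(1 /
    N ^ 2)] ([Gamma_factor_bound]). A product with summable deviations from [1]
    converges, and so does that of the inverses, so the limit is not zero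
    ([ccvg_product_inv]). The functional equation then passes to the limit from
    the terms. *)

Set Implicit Arguments.
Unset Strict Implicit.
Unset Printing Implicit Defensive.

Local Open Scope ring_scope.
Local Open Scope complex_scope.

(** * Contiguous relations of the Laguerre polynomials and iterated differences *)

Section LaguerreRecurrences.
Variable R : realType.
Local Notation C := (R[i]).
Implicit Types a x : C.

Lemma pochS a n : poch a n.+1 = poch a n * (a + n%:R).
Proof. by rewrite /poch big_ord_recr. Qed.

Lemma pochSl a n : poch a n.+1 = a * poch (a + 1) n.
Proof.
rewrite /poch big_ord_recl addr0; congr (_ * _).
by apply: eq_bigr => i _; rewrite /= /bump /= natrD addrA.
Qed.

Lemma poch_neq0 a n :
  (forall i, (i < n)%N -> a + i%:R != 0) -> poch a n != 0.
Proof. by move=> h; apply/prodf_neq0 => i _; apply: h. Qed.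

Lemma poch_factor_neq0 a n i : poch a n != 0 -> (i < n)%N -> a + i%:R != 0.
Proof. by move=> /prodf_neq0 h lt_in; apply: (h (Ordinal lt_in)). Qed.

Lemma fact_neq0 n : (n`!)%:R != 0 :> C.
Proof. by rewrite pnatr_eq0 -lt0n fact_gt0. Qed.

Lemma succ_neq0 n : n.+1%:R != 0 :> C.
Proof. by rewrite pnatr_eq0. Qed.

Lemma neq0_eq (u v : C) : u = v -> u != 0 -> v != 0.
Proof. by move=> ->. Qed.

Definition laguerre_coef (m : nat) a (j : nat) : C :=
  poch (a + j%:R + 1) (m - j) / ((m - j)`! * j`!)%:R.

Lemma laguerreE (m : nat) a x :
  laguerre m%:Z a x = \sum_(j < m.+1) laguerre_coef m a j * (- x) ^+ j.
Proof. by []. Qed.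

Lemma laguerre_coef_diag m a b : laguerre_coef m a m = laguerre_coef m b m.
Proof. by rewrite /laguerre_coef subnn /poch !big_ord0. Qed.

(** The two Pochhammer products share the factors from [a + j + 2] to
    [a + m + 1]; the extra end factors [a + m + 2] and [a + j + 1] differ by
    [m + 1 - j], which cancels against the factorial. *)
Lemma laguerre_coef_pascal m a j : (j <= m)%N ->
  laguerre_coef m.+1 (a + 1) j - laguerre_coef m.+1 a j = laguerre_coef m (a + 1) j.
Proof.
move=> /subnK <-; move: (m - j)%N => p.
rewrite /laguerre_coef subSn ?leq_addl // addnK [poch (a + _ + 1) _]pochSl pochS.
have -> : a + 1 + j%:R + 1 = a + j%:R + 1 + 1 by ring.
rewrite factS !natrM.
by field; rewrite !fact_neq0 /= nat1r succ_neq0.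
Qed.

Lemma laguerre_coef_degree m a j : (j <= m)%N ->
  (m.+1 - j)%:R * laguerre_coef m.+1 a j = (m%:R + a + 1) * laguerre_coef m a j.
Proof.
move=> /subnK <-; move: (m - j)%N => p.
rewrite /laguerre_coef subSn ?leq_addl // addnK pochS factS !natrM natrD.
by field; rewrite !fact_neq0 /= nat1r succ_neq0.
Qed.

(** Coefficient form of the derivative rule: [x d/dx] multiplies the
    coefficient of index [j + 1] by [j + 1]. *)
Lemma laguerre_coef_shift m a j : (j <= m)%N ->
  j.+1%:R * laguerre_coef m.+1 a j.+1 = laguerre_coef m (a + 1) j.
Proof.
move=> le_jm; rewrite /laguerre_coef subSS factS !natrM.
have -> : a + 1 + j%:R + 1 = a + j.+1%:R + 1 by ring.
by field; rewrite !fact_neq0 /= nat1r succ_neq0.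
Qed.

Lemma laguerre_pascal_nat (m : nat) a x :
  laguerre m.+1%:Z (a + 1) x - laguerre m.+1%:Z a x = laguerre m%:Z (a + 1) x.
Proof.
rewrite !laguerreE big_ord_recr [X in _ - X]big_ord_recr /=.
rewrite (laguerre_coef_diag m.+1 (a + 1) a) opprD addrACA subrr addr0 -sumrB.
by apply: eq_bigr => j _; rewrite -mulrBl laguerre_coef_pascal // -ltnS.
Qed.

(** Stated for integer degrees because the iterated differences in the degree
    run through negative degrees; in degree [-1] it reads [1 - 1 = 0]. *)
Lemma laguerre_pascal (m : int) a x :
  laguerre (m + 1) (a + 1) x - laguerre (m + 1) a x = laguerre m (a + 1) x.
Proof.
case: m => [m|[|m]].
- by rewrite -PoszD addn1 laguerre_pascal_nat.
- by rewrite /= !big_ord1 !subn0 /poch !big_ord0 subrr.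
- by rewrite NegzE -addn1 PoszD opprD addrNK -NegzE subrr.
Qed.

(** Write [m + 1 = (m + 1 - j) + j] in front of the coefficient of index [j]:
    the first part gives the multiple of [laguerre m a], the second one is
    [x d/dx] and gives [- x * laguerre m (a + 1)]. *)
Lemma laguerre_degree (m : nat) a x :
  m.+1%:R * laguerre m.+1%:Z a x =
  (m%:R + a + 1) * laguerre m%:Z a x - x * laguerre m%:Z (a + 1) x.
Proof.
rewrite !laguerreE.
transitivity (\sum_(j < m.+2) (m.+1 - j)%:R * laguerre_coef m.+1 a j * (- x) ^+ j +
              \sum_(j < m.+2) j%:R * laguerre_coef m.+1 a j * (- x) ^+ j).
  rewrite mulr_sumr -big_split; apply: eq_bigr => j _ /=.
  by rewrite natrB -1?ltnS //; ring.
congr (_ + _).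
  rewrite big_ord_recr /= subnn !mul0r addr0 mulr_sumr.
  by apply: eq_bigr => j _; rewrite laguerre_coef_degree 1?mulrA // -ltnS.
rewrite big_ord_recl /= !mul0r add0r -mulNr mulr_sumr.
apply: eq_bigr => j _; rewrite /bump /= add1n laguerre_coef_shift -1?ltnS // exprS.
by rewrite mulrCA.
Qed.

Lemma iter_fdiff_degree (c : int) b x i (m : int) :
  iter i (@fdiff int C) (fun m => laguerre (m - c) b x) m =
  laguerre (m - c + i%:Z) (b - i%:R) x.
Proof.
elim: i m => [|i IH] m; first by rewrite ?mulr0n ?subr0 ?addr0 ?subr0.
rewrite iterS /fdiff !IH.
have := laguerre_pascal (m - c + i%:Z) (b - i.+1%:R) x.
have -> : b - i.+1%:R + 1 = b - i%:R by ring.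
have -> : m - c + i%:Z + 1 = m + 1 - c + i%:Z by ring.
have -> : m - c + i.+1%:Z = m + 1 - c + i%:Z by rewrite -addn1 PoszD; ring.
by move=> <-; ring.
Qed.

Lemma iter_fdiff_param (m : int) x i a :
  iter i (@fdiff C C) (fun a => laguerre m a x) a =
  laguerre (m - i%:Z) (a + i%:R) x.
Proof.
elim: i a => [|i IH] a; first by rewrite ?mulr0n ?subr0 ?addr0 ?subr0.
rewrite iterS /fdiff !IH.
have := laguerre_pascal (m - i.+1%:Z) (a + i%:R) x.
have -> : m - i.+1%:Z + 1 = m - i%:Z by rewrite -addn1 PoszD; ring.
have -> : a + i%:R + 1 = a + i.+1%:R by ring.
by move=> <-; congr (laguerre _ _ _ - _); ring.
Qed.

(** Over the common denominator [poch (a + 1) N], a backward difference of two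
    consecutive terms is the combination of neighbouring degrees that
    [laguerre_degree] evaluates, so each difference contributes a factor
    [- x], lowers the degree and raises the parameter. *)
Lemma iter_bdiff_degree (k : nat) a x i N : (i <= N)%N ->
  poch (a + 1) N != 0 ->
  iter i (@bdiff int C)
    (fun m => ((absz (m + k%:Z))`!)%:R / poch (a + 1) (absz (m + k%:Z))
              * laguerre (m + k%:Z) a x) (N%:Z - k%:Z) =
  (- x) ^+ i * ((N - i)`!)%:R / poch (a + 1) N
    * laguerre (N - i)%N%:Z (a + i%:R) x.
Proof.
elim: i N => [|i IH] N.
  by rewrite /= addrNK absz_nat subn0 addr0 mul1r.
case: N => // N; rewrite ltnS subSS => /subnK <-.
move: (N - i)%N => p pN0.
have [pN aN] : poch (a + 1) (p + i) != 0 /\ a + 1 + (p + i)%:R != 0.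
  by apply/andP; rewrite -negb_or -mulf_eq0 -pochS.
rewrite iterS /bdiff.
have -> : (p + i).+1%:Z - k%:Z - 1 = (p + i)%N%:Z - k%:Z.
  by rewrite -addn1 PoszD; ring.
rewrite !IH // ?leq_addl ?leqW ?leq_addl // subSn ?leq_addl // addnK.
have -> : laguerre p.+1%:Z (a + i%:R) x =
   ((p%:R + (a + i%:R) + 1) * laguerre p%:Z (a + i%:R) x
     - x * laguerre p%:Z (a + i%:R + 1) x) / p.+1%:R.
  by rewrite -laguerre_degree mulrC mulKf // succ_neq0.
have -> : a + i.+1%:R = a + i%:R + 1 by ring.
rewrite factS pochS natrM exprS.
by field; rewrite -natrD aN pN nat1r succ_neq0.
Qed.

(** Combination of [laguerre_pascal] at parameter [a - 1], which expresses the
    polynomial of parameter [a - 1] through parameter [a], with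
    [laguerre_degree]. *)
Lemma laguerre_param_down (m : nat) a x :
  a * laguerre m.+1%:Z a x - (a + m%:R + 1) * laguerre m.+1%:Z (a - 1) x =
  x * laguerre m%:Z (a + 1) x.
Proof.
have := laguerre_pascal_nat m (a - 1) x; rewrite subrK => E.
have {E} -> : laguerre m.+1%:Z (a - 1) x =
  laguerre m.+1%:Z a x - laguerre m%:Z a x by rewrite -E; ring.
have -> : x * laguerre m%:Z (a + 1) x =
  (m%:R + a + 1) * laguerre m%:Z a x - m.+1%:R * laguerre m.+1%:Z a x.
  by rewrite laguerre_degree; ring.
by ring.
Qed.

(** The [i] innermost factors raise the parameter by [i] and lower the degree
    by [i]. Each new factor is [laguerre_param_down], since dividing [poch b (p
    + 2)] by [(b + 1) b] leaves [poch (b + 2) p]. The hypothesis covers all the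
    points [a - l] at which the nested differences evaluate their argument. *)
Lemma rodrigues_bdiffE x i p a :
  (forall l, (l <= i)%N -> poch (a - l%:R + 1) (p + i) != 0) ->
  rodrigues_bdiff i
    (fun a => laguerre (p + i)%N%:Z a x / poch (a + 1) (p + i)) a =
  x ^+ i * laguerre p%:Z (a + i%:R) x / poch (a + i%:R + 1) p.
Proof.
elim: i p a => [|i IH] p a h.
  by rewrite /= addn0 addr0 expr0 mul1r.
rewrite addnS -addSn in h *.
rewrite /= /bdiff !IH; first last.
- by move=> l le_li; apply: h; exact: leqW.
- move=> l le_li; apply: neq0_eq (h l.+1 le_li); congr (poch _ _); ring.
set b := a + i%:R.
(* At l = 0 the hypothesis gives the factors from a + 1 on; b is a when
   i = 0, so the case s = 0 uses l = 1. *)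
have hb s : (s < p.+2)%N -> b + s%:R != 0.
  case: s => [_|s lt_sp].
    have := @poch_factor_neq0 _ _ i (h 1%N isT).
    rewrite addSn ltnS leq_addl => /(_ isT).
    by apply: neq0_eq; rewrite /b; ring.
  have := @poch_factor_neq0 _ _ (s + i) (h 0%N isT).
  rewrite ltn_add2r => /(_ lt_sp).
  by apply: neq0_eq; rewrite /b; ring.
have -> : a - 1 + i%:R = b - 1 by rewrite /b; ring.
have -> : a + i.+1%:R = b + 1 by rewrite /b; ring.
rewrite subrK addrK.
have b0 : b != 0 by have := hb 0%N isT; rewrite addr0.
have b1 : b + 1 != 0 by exact: (hb 1%N).
have q0 : poch (b + 1 + 1) p != 0.
  apply: poch_neq0 => s lt_sp; apply: neq0_eq (hb s.+2 lt_sp); ring.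
have bp : b + p%:R + 1 != 0.
  by apply: neq0_eq (hb p.+1 (ltnSn _)); ring.
have -> : poch b p.+1 = b * ((b + 1) * poch (b + 1 + 1) p) / (b + p%:R + 1).
  rewrite -!pochSl [poch b p.+2]pochS.
  have -> : b + p.+1%:R = b + p%:R + 1 by ring.
  by rewrite mulfK.
rewrite [poch (b + 1) p.+1]pochSl exprS.
rewrite -!mulrA [x * (_ * _)]mulrCA [x * _]mulrA -(laguerre_param_down p b x).
by field; rewrite q0 bp b1 b0.
Qed.

End LaguerreRecurrences.

(** * Second order estimates for the real exponential, sine and cosine *)

Section RealEstimates.
Variable R : realType.
Implicit Types s t : R.

(** The upper bound comes from [1 - s <= expR (- s)], that is
    [expR s <= 1 / (1 - s)], and [1 / (1 - s) - 1 - s = s ^+ 2 / (1 - s)]. *)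
Lemma expR_taylor1 s : `|s| <= 2^-1 -> 0 <= expR s - 1 - s <= 2 * s ^+ 2.
Proof.
rewrite ler_norml => /andP[s1 s2].
have h1 := expR_ge1Dx s; have h2 := expR_ge1Dx (- s).
have e0 := expR_gt0 s.
have e1 : expR s * expR (- s) = 1 by rewrite -expRD subrr expR0.
apply/andP; split; first lra.
have h3 : expR s * (1 - s) <= 1 by rewrite -[leRHS]e1 ler_wpM2l // ltW.
suff : (expR s - 1 - s) * (1 - s) <= (2 * s ^+ 2) * (1 - s).
  by rewrite ler_pM2r //; lra.
have : 0 <= s ^+ 2 * (2^-1 - s) by rewrite mulr_ge0 ?sqr_ge0 //; lra.
nra.
Qed.

Lemma sin_le_norm s : `|sin s| <= `|s|.
Proof.
wlog s0 : s / 0 <= s.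
  move=> H; have [/H//|s0] := leP 0 s.
  by rewrite -normrN -sinN -[`|s|]normrN; apply: H; lra.
have [|c _] := @MVT_segment R (@sin R) (@cos R) 0 s s0 (fun y _ => is_derive_sin y).
  by apply: continuous_subspaceT => y; exact: continuous_sin.
rewrite sin0 !subr0 => ->; rewrite normrM ler_piMl //; exact: cos_max.
Qed.

Lemma cos_1sin s : 1 - cos s = 2 * sin (s / 2) ^+ 2.
Proof.
have {1}-> : s = (s / 2) *+ 2 by rewrite -mulr_natr mulfVK // pnatr_eq0.
by rewrite cos_mulr2n sin2cos2; ring.
Qed.

Lemma cos_taylor s : `|cos s - 1| <= s ^+ 2 / 2.
Proof.
have : sin (s / 2) ^+ 2 <= (s / 2) ^+ 2.
  rewrite -[leLHS]real_normK ?num_real // -[leRHS]real_normK ?num_real //.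
  by rewrite ler_sqr ?nnegrE // sin_le_norm.
rewrite expr_div_n distrC cos_1sin ger0_norm; first lra.
by rewrite mulr_ge0 ?sqr_ge0.
Qed.

Lemma sin_taylor s : `|sin s - s| <= s ^+ 2.
Proof.
wlog s0 : s / 0 <= s.
  move=> H; have [/H//|s0] := leP 0 s.
  have /H : 0 <= - s by lra.
  have -> : sin (- s) - - s = - (sin s - s) by rewrite sinN; ring.
  by rewrite normrN sqrrN.
have dsin (y : R) : y \in `]0, s[ -> is_derive y 1 (fun y => sin y - y) (cos y - 1).
  by move=> _; apply: is_deriveB.
have [|c] := MVT_segment s0 dsin.
  apply: continuous_subspaceT => y.
  by apply: cvgB; [exact: continuous_sin|exact: cvg_id].
rewrite in_itv /= => /andP[c0 cs]; rewrite sin0 !subr0 => ->.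
rewrite normrM (ger0_norm s0) expr2 ler_wpM2r // distrC cos_1sin.
rewrite ger0_norm; last by rewrite mulr_ge0 ?sqr_ge0.
have m1 : `|sin (c / 2)| <= c / 2.
  by rewrite (le_trans (sin_le_norm _)) // ger0_norm // divr_ge0.
have : sin (c / 2) ^+ 2 <= `|sin (c / 2)|.
  by rewrite -[leLHS]real_normK ?num_real // expr2 ler_piMl // sin_max.
lra.
Qed.

End RealEstimates.

(** * Modulus, exponential and powers of complex numbers *)

Section ComplexExponential.
Variable R : realType.
Local Notation C := (R[i]).
Implicit Types z w a x : C.

Lemma cmodE z : cmod z = ComplexField.Normc.normc z.
Proof. by case: z. Qed.

Lemma cmod_ge0 z : 0 <= cmod z.
Proof. exact: sqrtr_ge0. Qed.

Lemma cmodM z w : cmod (z * w) = cmod z * cmod w.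
Proof. by rewrite !cmodE ComplexField.Normc.normcM. Qed.

Lemma cmodV z : cmod z^-1 = (cmod z)^-1.
Proof. by rewrite !cmodE ComplexField.Normc.normcV. Qed.

Lemma cmodN z : cmod (- z) = cmod z.
Proof. by case: z => a b; rewrite /cmod /= !sqrrN. Qed.

Lemma cmodD z w : cmod (z + w) <= cmod z + cmod w.
Proof. by rewrite !cmodE; exact: le_normcD. Qed.

Lemma cmod_eq0 z : (cmod z == 0) = (z == 0).
Proof.
apply/eqP/eqP => [|->]; first by rewrite cmodE => /ComplexField.Normc.eq0_normc.
by rewrite cmodE ComplexField.Normc.normc0.
Qed.

Lemma cmod_gt0 z : (0 < cmod z) = (z != 0).
Proof. by rewrite lt_def cmod_ge0 andbT cmod_eq0. Qed.

Lemma cmod_real (r : R) : cmod r%:C = `|r|.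
Proof. by rewrite /cmod /= expr0n addr0 sqrtr_sqr. Qed.

Lemma sqr_cmod z : cmod z ^+ 2 = complex.Re z ^+ 2 + complex.Im z ^+ 2.
Proof. by rewrite sqr_sqrtr // addr_ge0 ?sqr_ge0. Qed.

Lemma Re_le_cmod z : `|complex.Re z| <= cmod z.
Proof.
by rewrite -ler_sqr ?nnegrE ?cmod_ge0 // sqr_cmod real_normK ?num_real // lerDl sqr_ge0.
Qed.

Lemma Im_le_cmod z : `|complex.Im z| <= cmod z.
Proof.
by rewrite -ler_sqr ?nnegrE ?cmod_ge0 // sqr_cmod real_normK ?num_real // lerDr sqr_ge0.
Qed.

Lemma cmod_le_ReIm z : cmod z <= `|complex.Re z| + `|complex.Im z|.
Proof.
rewrite -ler_sqr ?nnegrE ?cmod_ge0 ?addr_ge0 // sqr_cmod sqrrD.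
rewrite !real_normK ?num_real //.
by rewrite addrAC lerDl mulrn_wge0 // mulr_ge0.
Qed.

Lemma cexpD z w : cexp (z + w) = cexp z * cexp w.
Proof.
case: z w => [a b] [c d]; rewrite /cexp /= expRD cosD sinD.
by apply/eqP; rewrite eq_complex /=; apply/andP; split; apply/eqP; ring.
Qed.

Lemma cexp0 : cexp 0 = 1 :> C.
Proof. by rewrite /cexp /= expR0 cos0 sin0 mulr1 mulr0. Qed.

Lemma cexpNK z : cexp (- z) * cexp z = 1.
Proof. by rewrite -cexpD addNr cexp0. Qed.

Lemma cexp_neq0 z : cexp z != 0.
Proof.
by apply/eqP => z0; have /eqP := cexpNK z; rewrite z0 mulr0 eq_sym oner_eq0.
Qed.

(** The case distinction in [carg] restores the sign of the imaginary part,
    which [sin (acos _)] only gives up to absolute value. *)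
Lemma cexp_clog x : x != 0 -> cexp (clog x) = x.
Proof.
move=> x0; have m0 : 0 < cmod x by rewrite cmod_gt0.
rewrite /cexp /clog /= lnK //.
have ReD : -1 <= complex.Re x / cmod x <= 1.
  by rewrite -ler_norml normrM normfV (ger0_norm (cmod_ge0 x))
    ler_pdivrMr // mul1r Re_le_cmod.
have sE : sin (acos (complex.Re x / cmod x)) = `|complex.Im x| / cmod x.
  rewrite sin_acos //.
  have -> : 1 - (complex.Re x / cmod x) ^+ 2 = (complex.Im x / cmod x) ^+ 2.
    rewrite !expr_div_n sqr_cmod.
    have : complex.Re x ^+ 2 + complex.Im x ^+ 2 != 0.
      by rewrite -sqr_cmod expf_neq0 // gt_eqF.
    by move=> h; field.
  by rewrite sqrtr_sqr normrM normfV (ger0_norm (cmod_ge0 x)).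
have cE : cos (carg x) = complex.Re x / cmod x.
  by rewrite /carg; case: ifP => _; rewrite ?cosN acosK // in_itv.
have -> : sin (carg x) = complex.Im x / cmod x.
  rewrite /carg; case: ifP => [i0|/negbT]; first by rewrite sE ger0_norm.
  by rewrite -ltNge => i0; rewrite sinN sE ltr0_norm // mulNr opprK.
rewrite cE ![cmod x * _]mulrC !divfK ?gt_eqF //.
by case: x {x0 m0 ReD sE cE}.
Qed.

Lemma cpowS x a : x != 0 -> cpow x (a + 1) = cpow x a * x.
Proof. by move=> x0; rewrite /cpow mulrDl mul1r cexpD cexp_clog. Qed.

Lemma cpow_neq0 x a : cpow x a != 0.
Proof. exact: cexp_neq0. Qed.

Lemma natrC n : n%:R = (n%:R : R)%:C :> C.
Proof. by rewrite rmorph_nat. Qed.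

Lemma clog_nat n : clog (n.+1%:R : C) = (ln n.+1%:R)%:C.
Proof.
rewrite natrC /clog cmod_real ger0_norm // /carg /= lexx cmod_real ger0_norm //.
by rewrite divff ?acos1.
Qed.

Lemma cexp_taylor z : cmod z <= 2^-1 ->
  cmod (cexp z - 1 - z) <= 4 * cmod z ^+ 2.
Proof.
move=> z1; apply: le_trans (cmod_le_ReIm _) _; rewrite sqr_cmod.
have := le_trans (Re_le_cmod z) z1.
case: z {z1} => s b /= s1; rewrite subr0.
have /andP[e1 e2] := expR_taylor1 s1.
have c1 := cos_taylor b; have c2 := sin_taylor b.
have [s2 s3] : - 2^-1 <= s /\ s <= 2^-1 by apply/andP; rewrite -ler_norml.
have eD : expR s <= 2 by nra.
have e0 := expR_gt0 s.
have -> : expR s * cos b - 1 - s = expR s * (cos b - 1) + (expR s - 1 - s) by ring.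
have -> : expR s * sin b - b = expR s * (sin b - b) + b * (expR s - 1) by ring.
have h1 : `|expR s * (cos b - 1) + (expR s - 1 - s)| <= b ^+ 2 + 2 * s ^+ 2.
  apply: le_trans (ler_normD _ _) _.
  rewrite normrM (ger0_norm e1) (gtr0_norm e0) lerD //.
  have -> : b ^+ 2 = 2 * (b ^+ 2 / 2) by field.
  by apply: ler_pM => //; exact: ltW.
have h2 : `|expR s * (sin b - b) + b * (expR s - 1)| <= 3 * b ^+ 2 + s ^+ 2.
  apply: le_trans (ler_normD _ _) _; rewrite !normrM (gtr0_norm e0).
  have t1 : expR s * `|sin b - b| <= 2 * b ^+ 2.
    by apply: ler_pM => //; exact: ltW.
  have t2 : `|expR s - 1| <= 2 * `|s|.
    have -> : expR s - 1 = s + (expR s - 1 - s) by ring.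
    apply: le_trans (ler_normD _ _) _; rewrite (ger0_norm e1).
    have : s ^+ 2 <= 2^-1 * `|s|.
      by rewrite -real_normK ?num_real // expr2 ler_wpM2r.
    lra.
  have t3 : `|b| * `|expR s - 1| <= `|b| * (2 * `|s|) by rewrite ler_wpM2l.
  have : 0 <= (`|b| - `|s|) ^+ 2 by exact: sqr_ge0.
  rewrite sqrrB !real_normK ?num_real //.
  lra.
have := sqr_ge0 s; lra.
Qed.

End ComplexExponential.

(** * Convergence of complex infinite products *)

Section InfiniteProducts.
Variable R : realType.
Local Notation C := (R[i]).
Implicit Types (u v p : nat -> C) (l : C).

(** Componentwise convergence: this is the sense in which the limit defining
    [Gamma] is taken. *)
Definition ccvg u l :=
  ((fun n => complex.Re (u n)) @ \oo --> complex.Re l)%classic /\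
  ((fun n => complex.Im (u n)) @ \oo --> complex.Im l)%classic.

Lemma ccvg_unique u l l' : ccvg u l -> ccvg u l' -> l = l'.
Proof.
case: l l' => a b [c d] [/= ha hb] [/= hc hd].
by congr (_ +i* _); [exact: cvg_unique ha hc|exact: cvg_unique hb hd].
Qed.

Lemma ccvg_cst l : ccvg (fun=> l) l.
Proof. by split; exact: cvg_cst. Qed.

Lemma ccvgD u v l l' : ccvg u l -> ccvg v l' -> ccvg (fun n => u n + v n) (l + l').
Proof.
move=> [h1 h2] [h3 h4]; split.
  rewrite raddfD; under eq_fun do rewrite raddfD; exact: cvgD.
by rewrite raddfD; under eq_fun do rewrite raddfD; exact: cvgD.
Qed.

Lemma ReM l l' : complex.Re (l * l') =
  complex.Re l * complex.Re l' - complex.Im l * complex.Im l'.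
Proof. by case: l l' => a b [c d]. Qed.

Lemma ImM l l' : complex.Im (l * l') =
  complex.Re l * complex.Im l' + complex.Im l * complex.Re l'.
Proof. by case: l l' => a b [c d]. Qed.

Lemma ccvgM u v l l' : ccvg u l -> ccvg v l' -> ccvg (fun n => u n * v n) (l * l').
Proof.
move=> [h1 h2] [h3 h4]; split.
  rewrite ReM; under eq_fun do rewrite ReM.
  by apply: cvgB; exact: cvgM.
rewrite ImM; under eq_fun do rewrite ImM.
by apply: cvgD; exact: cvgM.
Qed.

Lemma ccvg_shift k u l : ccvg (fun n => u (n + k)%N) l <-> ccvg u l.
Proof.
rewrite /ccvg; split => -[h1 h2]; split.
- by move: h1; rewrite (cvg_shiftn k (fun n => complex.Re (u n))).
- by move: h2; rewrite (cvg_shiftn k (fun n => complex.Im (u n))).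
- by rewrite (cvg_shiftn k (fun n => complex.Re (u n))).
- by rewrite (cvg_shiftn k (fun n => complex.Im (u n))).
Qed.

Lemma cvg_abs_increments (f w : nat -> R) :
  cvgn (series w) -> (forall n, `|f n.+1 - f n| <= w n) -> cvgn f.
Proof.
move=> cw fw.
have cs : cvgn (series (fun n => f n.+1 - f n)).
  apply: normed_cvg; apply: (series_le_cvg _ _ fw cw) => n //.
  exact: le_trans (fw n).
have fE : f = (fun n => f 0%N + series (fun n => f n.+1 - f n) n).
  apply/funext => n; rewrite /series /= telescope_sumr //; ring.
by rewrite fE; apply: is_cvgD => //; exact: is_cvg_cst.
Qed.

(** Convergence of the product of the factors [1 + v n], where
    [p n.+1 = p n * (1 + v n)] and [w] is a summable bound of the moduli of
    [v]. Since [1 + w n <= expR (w n)], the partial products stay bounded, so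
    their increments are summable. *)
Lemma ccvg_product p (w : nat -> R) :
  cvgn (series w) -> (forall n, 0 <= w n) ->
  (forall n, cmod (p n.+1 - p n) <= cmod (p n) * w n) ->
  exists l, ccvg p l.
Proof.
move=> cw w0 pw.
have bd n : cmod (p n) <= cmod (p 0%N) * expR (series w n).
  elim: n => [|n IH]; first by rewrite /series /= big_geq // expR0 mulr1.
  have -> : p n.+1 = p n + (p n.+1 - p n) by ring.
  apply: le_trans (cmodD (p n) (p n.+1 - p n)) _.
  apply: (@le_trans _ _ (cmod (p n) * (1 + w n))).
    by rewrite mulrDr mulr1 lerD2l.
  rewrite /series /= big_nat_recr //= expRD mulrA.
  by apply: ler_pM => //; rewrite ?cmod_ge0 ?addr_ge0 // expR_ge1Dx.
pose B := cmod (p 0%N) * expR (limn (series w)).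
have bdB n : cmod (p n) <= B.
  apply: le_trans (bd n) _; rewrite ler_wpM2l ?cmod_ge0 // ler_expR.
  apply: nondecreasing_cvgn_le => //.
  by apply/nondecreasing_seqP => m; rewrite /series /= big_nat_recr //= lerDl.
have cBw : cvgn (series (fun n => B * w n)).
  have -> : series (fun n => B * w n) = (fun n => B * series w n).
    by apply/funext => n; rewrite /series /= mulr_sumr.
  by apply: is_cvgM => //; exact: is_cvg_cst.
have inc n : cmod (p n.+1 - p n) <= B * w n.
  by apply: le_trans (pw n) _; rewrite ler_wpM2r.
have cRe : cvgn (fun n => complex.Re (p n)).
  apply: (cvg_abs_increments cBw) => n; rewrite -raddfB.
  exact: le_trans (Re_le_cmod _) (inc n).
have cIm : cvgn (fun n => complex.Im (p n)).
  apply: (cvg_abs_increments cBw) => n; rewrite -raddfB.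
  exact: le_trans (Im_le_cmod _) (inc n).
by exists (limn (fun n => complex.Re (p n)) +i* limn (fun n => complex.Im (p n))).
Qed.

(** When moreover [w n <= 1 / 2], the inverses [(p n)^-1] satisfy the same kind
    of estimate with [2 * w n], hence converge too; the product of the two
    limits is [1], so neither vanishes. *)
Lemma ccvg_product_inv p (w : nat -> R) :
  cvgn (series w) -> (forall n, 0 <= w n <= 2^-1) -> (forall n, p n != 0) ->
  (forall n, cmod (p n.+1 - p n) <= cmod (p n) * w n) ->
  exists2 l, l != 0 & ccvg (fun n => (p n)^-1) l.
Proof.
move=> cw w01 p0 pw.
have w0 n : 0 <= w n by case/andP: (w01 n).
have [l pl] := ccvg_product cw w0 pw.
have c2w : cvgn (series (fun n => 2 * w n)).
  have -> : series (fun n => 2 * w n) = (fun n => 2 * series w n).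
    by apply/funext => n; rewrite /series /= mulr_sumr.
  by apply: is_cvgM => //; exact: is_cvg_cst.
have [||l' pl'] := @ccvg_product (fun n => (p n)^-1) _ c2w.
- by move=> n; rewrite mulr_ge0.
- move=> n.
  have -> : (p n.+1)^-1 - (p n)^-1 = - ((p n.+1 - p n) * (p n)^-1 * (p n.+1)^-1).
    by field; rewrite !p0.
  rewrite cmodN !cmodM !cmodV.
  have pn := p0 n; have pn1 := p0 n.+1; rewrite -!cmod_gt0 in pn pn1.
  have half : cmod (p n) <= 2 * cmod (p n.+1).
    have := cmodD (p n.+1) (- (p n.+1 - p n)); rewrite cmodN.
    have -> : p n.+1 + - (p n.+1 - p n) = p n by ring.
    have /andP[_ w1] := w01 n; have := pw n; nra.
  rewrite ler_pdivrMr // ler_pdivrMr //.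
  have -> : (cmod (p n))^-1 * (2 * w n) * cmod (p n.+1) * cmod (p n) =
            2 * cmod (p n.+1) * w n by field; rewrite gt_eqF.
  by apply: le_trans (pw n) _; rewrite ler_wpM2r.
exists l' => //; apply/eqP => l'0.
have : ccvg (fun n => p n * (p n)^-1) (l * l') by exact: ccvgM.
rewrite l'0 mulr0; under eq_fun do rewrite divff //.
by move/(ccvg_unique (ccvg_cst 1))/eqP; rewrite oner_eq0.
Qed.

End InfiniteProducts.

(** * Convergence, non-vanishing and functional equation of Gamma *)

Section GammaFunction.
Variable R : realType.
Local Notation C := (R[i]).
Implicit Types z a x : C.

(** Both bounds are [ln (1 + y) <= y], for [y = 1 / N] and
    [y = - 1 / (N + 1)]. They are used because the error is then at most
    [1 / N - 1 / (N + 1)], which telescopes. *)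
Lemma ln_succ_bounds N : (0 < N)%N ->
  N.+1%:R^-1 <= ln (N.+1%:R : R) - ln N%:R <= N%:R^-1.
Proof.
move=> N0; have n0 : 0 < N%:R :> R by rewrite ltr0n.
have n1 : 0 < N.+1%:R :> R by rewrite ltr0n.
rewrite -ln_div ?posrE //; apply/andP; split.
  rewrite -[ln _]opprK -lnV ?posrE ?divr_gt0 // invf_div lerNr.
  have -> : N%:R / N.+1%:R = 1 + - N.+1%:R^-1 :> R.
    by field; rewrite nat1r gt_eqF.
  by apply: le_ln1Dx; rewrite ltrN2 invf_lt1 // ltr1n.
have -> : N.+1%:R / N%:R = 1 + N%:R^-1 :> R by field; rewrite gt_eqF.
by apply: le_ln1Dx; rewrite (lt_trans (_ : _ < 0)) // invr_gt0.
Qed.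

Lemma cpow_succ N z : (0 < N)%N ->
  cpow N.+1%:R z = cpow N%:R z * cexp ((ln N.+1%:R - ln N%:R)%:C * z).
Proof.
case: N => // N _; rewrite /cpow !clog_nat -cexpD; congr cexp.
by rewrite raddfB; ring.
Qed.

Lemma nonpole_neq0 z j : ~ Gamma_pole z -> z + j%:R != 0.
Proof.
by move=> zP; rewrite addr_eq0; apply/eqP => zj; apply: zP; exists j.
Qed.

Lemma nonpoleS z : ~ Gamma_pole z -> ~ Gamma_pole (z + 1).
Proof.
move=> zP [j zj]; apply: zP; exists j.+1.
by rewrite -natr1 opprD -zj addrK.
Qed.

Lemma nonpoleD z j : ~ Gamma_pole z -> ~ Gamma_pole (z + j%:R).
Proof.
move=> zP; elim: j => [|j IHj]; first by rewrite addr0.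
by rewrite -natr1 addrA; exact: nonpoleS.
Qed.

Lemma Gamma_seq_neq0 z N : ~ Gamma_pole z -> Gamma_seq z N != 0.
Proof.
move=> zP; rewrite /Gamma_seq mulf_neq0 ?invr_eq0 //.
  by rewrite mulf_neq0 ?fact_neq0 ?cpow_neq0.
by apply: poch_neq0 => i _; exact: nonpole_neq0.
Qed.

Lemma Gamma_seq_inv_step z N : ~ Gamma_pole z -> (0 < N)%N ->
  (Gamma_seq z N.+1)^-1 = (Gamma_seq z N)^-1 *
    (cexp (- ((ln N.+1%:R - ln N%:R)%:C * z)) * (1 + z / N.+1%:R)).
Proof.
move=> zP N0; rewrite /Gamma_seq factS natrM pochS cpow_succ //.
set e := cexp (_ * z).
have -> : cexp (- ((ln N.+1%:R - ln N%:R)%:C * z)) = e^-1.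
  by rewrite -[LHS]mulr1 -(divff (cexp_neq0 _ : e != 0)) mulrA cexpNK mul1r.
have p0 : poch z N.+1 != 0.
  by apply: poch_neq0 => i _; exact: nonpole_neq0.
have := nonpole_neq0 N.+1 zP; have := succ_neq0 R N.
have := fact_neq0 R N; have := cpow_neq0 (N%:R : C) z.
have := cexp_neq0 (_ * z) : e != 0.
by move=> h1 h2 h3 h4 h5; field; rewrite nat1r h4 h1 p0 h2 h3 h5.
Qed.

(** The quotient of consecutive terms of [1 / Gamma_seq] is
    [cexp (- t z) * (1 + z / (N + 1))], where [t] is close to [1 / (N + 1)]; the
    terms of first order in [z] cancel and the rest is of order [1 / N ^ 2].
    The constant [17] is [4 * 2 * 2 + 1]: [4] from [cexp_taylor], [2] from
    [1 + z / (N + 1)], [2] from [1 / N ^ 2 <= 2 / (N * (N + 1))], and [1] from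
    the product of the two linear terms. *)
Lemma Gamma_factor_bound (N : nat) z : (0 < N)%N -> 2 * cmod z <= N%:R ->
  cmod (cexp (- ((ln N.+1%:R - ln N%:R)%:C * z)) * (1 + z / N.+1%:R) - 1) <=
  (cmod z + 17 * cmod z ^+ 2) * (N%:R^-1 - N.+1%:R^-1).
Proof.
move=> N0 zN; have := ln_succ_bounds N0; move: (ln _ - ln _) => t /andP[t1 t2].
have n0 : 0 < N%:R :> R by rewrite ltr0n.
have m0 : 0 < N.+1%:R :> R by rewrite ltr0n.
have n1 : 1 <= N%:R :> R by rewrite ler1n.
have mn : N.+1%:R = N%:R + 1 :> R by rewrite natr1.
set a := cmod z in zN *; have a0 : 0 <= a by exact: cmod_ge0.
have t0 : 0 <= t by apply: le_trans t1; rewrite invr_ge0 ltW.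
set M := (N.+1%:R : C).
have mE : cmod M^-1 = N.+1%:R^-1 by rewrite cmodV /M natrC cmod_real ger0_norm ?ltW.
have wE : cmod (- (t%:C * z)) = t * a by rewrite cmodN cmodM cmod_real ger0_norm.
have ta : t * a <= N%:R^-1 * a by rewrite ler_wpM2r.
have Na : N%:R^-1 * a <= 2^-1 by rewrite ler_pdivrMl //; lra.
have h1 : cmod (cexp (- (t%:C * z)) - 1 - - (t%:C * z)) <= 4 * (t * a) ^+ 2.
  by rewrite -wE; apply: cexp_taylor; rewrite wE (le_trans ta).
have h2 : cmod (1 + z * M^-1) <= 2.
  apply: le_trans (cmodD _ _) _; rewrite cmodM mE -/a.
  have -> : cmod (1 : C) = 1 by rewrite -[1]/((1 : R)%:C) cmod_real normr1.
  have : a * N.+1%:R^-1 <= 1 by rewrite ler_pdivrMr // mn; lra.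
  by move: (a / _) => y; lra.
have -> : cexp (- (t%:C * z)) * (1 + z / M) - 1 =
  (cexp (- (t%:C * z)) - 1 - - (t%:C * z)) * (1 + z * M^-1)
  + (z * (M^-1 - t%:C) + - (t%:C * z * (z * M^-1))) by ring.
set D := N%:R^-1 - N.+1%:R^-1.
have DE : N%:R^-1 * N.+1%:R^-1 = D by rewrite /D mn; field; rewrite -mn !gt_eqF.
have D0 : N%:R^-1 ^+ 2 <= 2 * D.
  rewrite -DE expr2 [leRHS]mulrCA ler_wpM2l ?invr_ge0 ?(ltW n0) //.
  by rewrite ler_pdivlMr // mulrC ler_pdivrMr // mn; lra.
have b1 : cmod ((cexp (- (t%:C * z)) - 1 - - (t%:C * z)) * (1 + z * M^-1))
          <= 16 * a ^+ 2 * D.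
  rewrite cmodM.
  apply: (@le_trans _ _ (4 * (t * a) ^+ 2 * 2)).
    by apply: ler_pM => //; exact: cmod_ge0.
  have : (t * a) ^+ 2 <= a ^+ 2 * (2 * D).
    apply: (@le_trans _ _ (a ^+ 2 * N%:R^-1 ^+ 2)); last by rewrite ler_wpM2l ?sqr_ge0.
    by rewrite -exprMn [a * _]mulrC lerXn2r ?nnegrE ?mulr_ge0 // invr_ge0 ltW.
  lra.
have b2 : cmod (z * (M^-1 - t%:C)) <= a * D.
  rewrite cmodM ler_wpM2l //.
  have -> : M^-1 - t%:C = (N.+1%:R^-1 - t)%:C.
    by rewrite rmorphB fmorphV rmorph_nat.
  by rewrite cmod_real distrC ger0_norm ?subr_ge0 // lerB.
have b3 : cmod (- (t%:C * z * (z * M^-1))) <= a ^+ 2 * D.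
  rewrite cmodN !cmodM mE cmod_real ger0_norm // -/a -DE.
  have -> : t * a * (a / N.+1%:R) = a ^+ 2 / N.+1%:R * t by ring.
  have -> : a ^+ 2 * (N%:R^-1 / N.+1%:R) = a ^+ 2 / N.+1%:R * N%:R^-1 by ring.
  by rewrite ler_wpM2l // mulr_ge0 ?sqr_ge0 ?invr_ge0 // ltW.
have := cmodD ((cexp (- (t%:C * z)) - 1 - - (t%:C * z)) * (1 + z * M^-1))
  (z * (M^-1 - t%:C) + - (t%:C * z * (z * M^-1))).
have := cmodD (z * (M^-1 - t%:C)) (- (t%:C * z * (z * M^-1))).
lra.
Qed.

(** The reciprocals of the terms from the index [N0] on are the partial products
    of an infinite product whose factors differ from [1] by at most the
    telescoping bound [w]; [N0] is chosen so that this bound is at most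
    [1 / 2] and [Gamma_factor_bound] applies. *)
Lemma Gamma_seq_cvg z : ~ Gamma_pole z ->
  exists2 l, l != 0 & ccvg (Gamma_seq z) l.
Proof.
move=> zP; have [a aE] : exists a : R, a = cmod z by exists (cmod z).
have a0 : 0 <= a by rewrite aE cmod_ge0.
have [K KE] : exists K, K = a + 17 * a ^+ 2 by exists (a + 17 * a ^+ 2).
have K0 : 0 <= K by rewrite KE addr_ge0 ?mulr_ge0 ?sqr_ge0.
pose N0 := (Num.bound (2 * a + 2 * K)).+1.
have N0K : 2 * a + 2 * K <= N0%:R.
  rewrite ltW // (lt_le_trans (archi_boundP _)) ?ler_nat ?leqnSn //.
  by rewrite addr_ge0 ?mulr_ge0.
pose h (n : nat) : R := (n + N0)%:R^-1.
pose w n := K * (h n - h n.+1).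
have Npos n : (0 < n + N0)%N by rewrite /N0 addnS.
have hpos n : 0 < h n by rewrite invr_gt0 ltr0n.
have NK n : 2 * a + 2 * K <= (n + N0)%:R.
  by apply: le_trans N0K _; rewrite ler_nat leq_addl.
have hle n : h n.+1 <= h n.
  by rewrite /h lef_pV2 ?posrE ?ltr0n // ler_nat addSn.
have cw : cvgn (series w).
  have -> : series w = (fun n => K * (h 0%N - h n)).
    apply/funext => n; rewrite /series /= /w -mulr_sumr; congr (_ * _).
    rewrite -[RHS]opprB -telescope_sumr // -sumrN.
    by apply: eq_bigr => i _; rewrite opprB.
  apply: is_cvgM; first exact: is_cvg_cst.
  apply: is_cvgB; first exact: is_cvg_cst.
  apply/cvg_ex; exists 0; rewrite /h /N0.
  under eq_fun do rewrite addnS.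
  by have := @cvg_harmonic R; rewrite -(cvg_shiftn (Num.bound (2 * a + 2 * K))).
have w01 n : 0 <= w n <= 2^-1.
  rewrite /w mulr_ge0 ?subr_ge0 //=.
  apply: (@le_trans _ _ (K * h n)).
    by rewrite ler_wpM2l // lerBlDr lerDl ltW.
  by rewrite ler_pdivrMr ?ltr0n //; have := NK n; lra.
have [||l l0 cl] := @ccvg_product_inv R (fun n => (Gamma_seq z (n + N0))^-1) w cw w01.
- by move=> n; rewrite invr_eq0 Gamma_seq_neq0.
- move=> n; rewrite addSn Gamma_seq_inv_step // -[X in _ - X]mulr1 -mulrBr cmodM.
  rewrite ler_wpM2l ?cmod_ge0 // /w /h addSn KE aE.
  by apply: Gamma_factor_bound => //; have := NK n; rewrite -aE; lra.
exists l => //; apply/(ccvg_shift N0).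
by move: cl; under eq_fun do rewrite invrK.
Qed.

Lemma Gamma_cvg z : ~ Gamma_pole z -> ccvg (Gamma_seq z) (Gamma z).
Proof.
move=> /Gamma_seq_cvg[l _ [h1 h2]].
by rewrite /Gamma (cvg_lim _ h1) // (cvg_lim _ h2).
Qed.

Lemma Gamma_neq0 z : ~ Gamma_pole z -> Gamma z != 0.
Proof.
by move=> zP; have [l l0 /(ccvg_unique (Gamma_cvg zP)) ->] := Gamma_seq_cvg zP.
Qed.

(** Take the limit in
    [Gamma_seq (z + 1) N * (1 + (z + 1) / N) = z * Gamma_seq z N]. *)
Lemma GammaS z : ~ Gamma_pole z -> Gamma (z + 1) = z * Gamma z.
Proof.
move=> zP.
have c1 := (ccvg_shift 1 _ _).2 (Gamma_cvg (nonpoleS zP)).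
have c0 := (ccvg_shift 1 _ _).2 (Gamma_cvg zP).
have ch : ccvg (fun n => ((n.+1%:R^-1 : R)%:C)) 0.
  by split; [exact: cvg_harmonic|exact: cvg_cst].
have := ccvgM c1 (ccvgD (ccvg_cst 1) (ccvgM (ccvg_cst (z + 1)) ch)).
rewrite mulr0 addr0 mulr1.
have -> : (fun n => Gamma_seq (z + 1) (n + 1) * (1 + (z + 1) * (n.+1%:R^-1)%:C)) =
          (fun n => z * Gamma_seq z (n + 1)).
  apply/funext => n; rewrite addn1 fmorphV rmorph_nat.
  rewrite /Gamma_seq cpowS ?succ_neq0 //.
  have z0 : z != 0 by have := nonpole_neq0 0%N zP; rewrite addr0.
  have -> : poch (z + 1) n.+2 = poch z n.+2 * (z + n.+2%:R) / z.
    by rewrite -pochS [in RHS]pochSl; field.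
  have p0 : poch z n.+2 != 0.
    by apply: poch_neq0 => i _; exact: nonpole_neq0.
  have := nonpole_neq0 n.+2 zP; have := succ_neq0 R n.
  by move=> h1 h2; field; rewrite p0 nat1r h1 z0 -(natrD _ 2) h2.
move=> c2; exact: ccvg_unique c2 (ccvgM (ccvg_cst z) c0).
Qed.

Lemma nonpole_nat n : ~ Gamma_pole (n.+1%:R : C).
Proof.
by move=> [j /eqP]; rewrite -addr_eq0 -natrD pnatr_eq0.
Qed.

(** The function of [a] differenced in the identity with [x ^ alpha], with the
    Pochhammer symbol replaced by the quotient of Gamma values; the factor
    [Gamma (m + 1)] makes its difference in [a] exactly minus the function for
    [m + 1]. *)
Definition cpow_laguerre x (m : nat) a : C :=
  cpow x a * Gamma (m%:R + 1) / Gamma (m%:R + 1 + a) * laguerre m%:Z a x.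

(** Over the common denominator [Gamma (m + 2 + a)], this is
    [laguerre_degree]. *)
Lemma fdiff_cpow_laguerre x m a : x != 0 -> ~ Gamma_pole (m%:R + 1 + a) ->
  cpow_laguerre x m (a + 1) - cpow_laguerre x m a = - cpow_laguerre x m.+1 a.
Proof.
move=> x0 aP; rewrite /cpow_laguerre cpowS //.
have -> : m%:R + 1 + (a + 1) = m%:R + 1 + a + 1 by ring.
have -> : m.+1%:R + 1 + a = m%:R + 1 + a + 1 by ring.
have -> : Gamma (m.+1%:R + 1) = m.+1%:R * Gamma (m%:R + 1) :> C.
  by rewrite -natr1 GammaS // natr1; exact: nonpole_nat.
have -> : laguerre m.+1%:Z a x =
  ((m%:R + a + 1) * laguerre m%:Z a x - x * laguerre m%:Z (a + 1) x) / m.+1%:R.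
  by rewrite -laguerre_degree mulrC mulKf // succ_neq0.
rewrite (GammaS aP).
have a0 : m%:R + 1 + a != 0 by have := nonpole_neq0 0 aP; rewrite addr0.
have G0 := Gamma_neq0 aP; have m0 := succ_neq0 R m.
by field; rewrite G0 a0 nat1r m0.
Qed.

Lemma iter_fdiff_cpow x (m : nat) i a : x != 0 ->
  ~ Gamma_pole (m%:R + 1 + a) ->
  iter i (@fdiff C C)
    (fun a => cpow x a / cpoch (m%:R + 1) a * laguerre m%:Z a x) a =
  (- 1) ^+ i * cpow_laguerre x (m + i) a.
Proof.
move=> x0; elim: i a => [|i IH] a aP.
  by rewrite /= addn0 mul1r /cpow_laguerre /cpoch invf_div mulrA.
rewrite iterS /fdiff !IH //; last by rewrite addrA; exact: nonpoleS.
have aPi : ~ Gamma_pole ((m + i)%:R + 1 + a).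
  have := nonpoleD (j := i) aP.
  by have -> : m%:R + 1 + a + i%:R = (m + i)%:R + 1 + a by ring.
by rewrite -mulrBr fdiff_cpow_laguerre // addnS exprS mulN1r mulrN mulNr.
Qed.

End GammaFunction.

(** * The Rodrigues-type identities *)

Theorem theorem4p4 (R : realType) (alpha x : R[i]) (n k : nat) :
  [/\ (x ^+ k != 0 ->
       (forall i : nat, (i <= k)%N -> poch (alpha - i%:R + 1) (n + k) != 0) ->
       laguerre n%:Z (alpha + k%:R) x =
         poch (alpha + k%:R + 1) n / x ^+ k *
         rodrigues_bdiff k
           (fun a => laguerre (n%:Z + k%:Z) a x / poch (a + 1) (n + k)) alpha),
      (x ^+ k != 0 ->
       poch (alpha + 1) (n + k) != 0 ->
       laguerre n%:Z (alpha + k%:R) x =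
         (-1) ^+ k * poch (alpha + 1) (n + k) / ((n`!)%:R * x ^+ k) *
         iter k (@bdiff int R[i])
           (fun m => ((absz (m + k%:Z))`!)%:R / poch (alpha + 1) (absz (m + k%:Z))
                     * laguerre (m + k%:Z) alpha x) n%:Z),
      ((k <= n)%N ->
       x != 0 ->
       ~ Gamma_pole (n%:R - k%:R + 1 + alpha) ->
       laguerre n%:Z alpha x =
         (-1) ^+ k * (cpoch (n%:R + 1) alpha / cpow x alpha) *
         iter k (@fdiff R[i] R[i])
           (fun a => cpow x a / cpoch (n%:R - k%:R + 1) a
                     * laguerre (n%:Z - k%:Z) a x) alpha),
      laguerre n%:Z alpha x =
        iter k (@fdiff int R[i])
          (fun m => laguerre (m - k%:Z) (alpha + k%:R) x) n%:Z
    & laguerre n%:Z (alpha + k%:R) x =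
        iter k (@fdiff R[i] R[i])
          (fun a => laguerre (n%:Z + k%:Z) a x) alpha].
Proof.
split.
- move=> xk0 h; rewrite -PoszD rodrigues_bdiffE //.
  have q0 : poch (alpha + k%:R + 1) n != 0.
    apply: poch_neq0 => i lt_in.
    have := @poch_factor_neq0 _ _ _ (k + i) (h 0%N (leq0n k)).
    rewrite addnC ltn_add2r => /(_ lt_in).
    by apply: neq0_eq; ring.
  by field; rewrite q0 xk0.
- move=> xk0 h.
  have := iter_bdiff_degree k x (leq_addl n k) h.
  rewrite PoszD addrK addnK => ->.
  rewrite -[- x]mulN1r exprMn.
  rewrite -[LHS](signrMK k); field.
  by rewrite xk0 h fact_neq0.
- move=> le_kn x0 aP.
  have mE : n%:R - k%:R = (n - k)%N%:R :> R[i].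
    by rewrite natrB ?le_kn.
  rewrite mE in aP *; rewrite subzn // iter_fdiff_cpow // subnK //.
  have nP : ~ Gamma_pole (n%:R + 1 + alpha).
    have := nonpoleD (j := k) aP.
    have -> // : (n - k)%N%:R + 1 + alpha + k%:R = n%:R + 1 + alpha.
    by rewrite -mE; ring.
  have G0 := Gamma_neq0 nP.
  have G1 : Gamma (n%:R + 1 : R[i]) != 0.
    by rewrite natr1; exact/Gamma_neq0/nonpole_nat.
  rewrite -[LHS](signrMK k) /cpow_laguerre /cpoch; field.
  by rewrite cpow_neq0 G0 G1.
- by rewrite iter_fdiff_degree subrK addrK.
- by rewrite iter_fdiff_param addrK.
Qed.
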